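(* Assume that $Y$ is a real locally convex space, $\psi:Y\to\mathbb R$ is a seminorm, and $K,A\subseteq Y$ are nontrivial cones with normlike-bases $B_K(\psi)$ and $B_A(\psi)$. Suppose that one of the sets $\operatorname{cl}S_{-K}(\psi)$ and $\operatorname{cl}S^0_A(\psi)$ is compact, and that $$A\cap\operatorname{cl}(\operatorname{conv}(-K))=\{0\}\quad\text{and}\quad 0\notin\operatorname{cl}S_{-K}(\psi).$$ Moreover, assume that one of the following is satisfied: (a) $A$ is closed and convex. (b) There is $(y^*,\beta)\in Y^*\times\mathbb P$ such that $\operatorname{cl}S_{-K}(\psi)=\{x\in\operatorname{cl}\mathbb B_\psi\mid y^*(x)\ge\beta\}$, and one of the following conditions is satisfied: (i) $B_A(\psi)$ is compact; (ii) $S^0_A(\psi)$ is closed; (iii) $A$ is closed and $\operatorname{cl}B_A(\psi)$ is compact; (iv) $A$ is closed and $\operatorname{conv}(\operatorname{cl}(B_A(\psi))\cup\{0\})$ is closed. Then there is $(x^*,\alpha)\in K^{a\#}(\psi)\cap(Y^*\times\mathbb P)$ such that $$A\cap(-C_\psi(x^*,\alpha))=\{0\}\quad\text{and}\quad K\setminus\{0\}\subseteq C^>_\psi(x^*,\alpha)=\operatorname{cor}C_\psi(x^*,\alpha).$$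
   Context: $Y^*$ is the topological dual of $Y$, $\mathbb R_+=[0,\infty)$, $\mathbb P=(0,\infty)$. A set $K\subseteq Y$ is a cone if $0\in K=\mathbb R_+\cdot K$ (not necessarily convex); it is nontrivial if $\{0\}\ne K\ne Y$. $\mathbb B_\psi:=\{y\in Y\mid\psi(y)\le1\}$. For a cone $C$: $B_C(\psi):=\{x\in C\mid\psi(x)=1\}$, $S_C(\psi):=\operatorname{conv}(B_C(\psi))$, $S^0_C(\psi):=\operatorname{conv}(\{0\}\cup B_C(\psi))$; $B_C(\psi)$ is a normlike-base for the nontrivial cone $C$ if $\psi>0$ on $C\setminus\{0\}$. $K^{a\#}(\psi):=\{(x^*,\alpha)\in Y^*\times\mathbb R_+\mid\forall y\in K\setminus\{0\}:\ x^*(y)-\alpha\psi(y)>0\}$. $C_\psi(x^*,\alpha):=\{y\in Y\mid x^*(y)\ge\alpha\psi(y)\}$, $C^>_\psi(x^*,\alpha):=\{y\in Y\mid x^*(y)>\alpha\psi(y)\}$. The algebraic interior is $\operatorname{cor}M:=\{x\in M\mid\forall v\in Y\ \exists\varepsilon>0:\ x+[0,\varepsilon]\cdot v\subseteq M\}$. *)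

(* Defs.v *)
From HB Require Import structures.
From mathcomp Require Import all_boot all_order all_algebra.
From mathcomp Require Import boolp classical_sets functions set_interval.
From mathcomp Require Import reals topology convex normedtype.

Set Implicit Arguments.
Unset Strict Implicit.
Unset Printing Implicit Defensive.

Import Order.TTheory GRing.Theory Num.Theory.
Import numFieldNormedType.Exports.

Local Open Scope classical_set_scope.
Local Open Scope ring_scope.

Definition topological_dual (R : realType) (Y : tvsType R) : set {scalar Y} :=
  [set f : {scalar Y} | continuous f].

(* Nonnegativity follows from the two axioms.  No continuity is required. *)
Definition seminorm (R : realType) (Y : lmodType R) (psi : Y -> R) : Prop :=
  (forall x y : Y, psi (x + y) <= psi x + psi y) /\
  (forall (r : R) (x : Y), psi (r *: x) = `|r| * psi x).

(* Cones are not required to be convex. *)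
Definition cone (R : realType) (Y : lmodType R) (K : set Y) : Prop :=
  K 0 /\ K = [set r *: x | r in [set r : R | 0 <= r] & x in K].

Definition nontrivial (R : realType) (Y : lmodType R) (K : set Y) : Prop :=
  [set 0] <> K /\ K <> [set: Y].

Definition oppset (R : realType) (Y : lmodType R) (M : set Y) : set Y :=
  [set - x | x in M].

Definition convex_hull (R : realType) (Y : lmodType R) (M : set Y) : set Y :=
  smallest (@convex_set R Y) M.

Definition unit_ball (R : realType) (Y : lmodType R) (psi : Y -> R) : set Y :=
  [set y | psi y <= 1].

(* B_C(psi); its hulls S_C(psi) and S^0_C(psi) are [base_hull] and
   [base_hull0]. *)
Definition base (R : realType) (Y : lmodType R) (C : set Y) (psi : Y -> R) :
    set Y :=
  [set x | C x /\ psi x = 1].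

Definition base_hull (R : realType) (Y : lmodType R) (C : set Y)
    (psi : Y -> R) : set Y :=
  convex_hull (base C psi).

Definition base_hull0 (R : realType) (Y : lmodType R) (C : set Y)
    (psi : Y -> R) : set Y :=
  convex_hull ([set 0] `|` base C psi).

Definition normlike_base (R : realType) (Y : lmodType R) (C : set Y)
    (psi : Y -> R) : Prop :=
  forall x, (C `\` [set 0]) x -> 0 < psi x.

Definition aug_dual_sharp (R : realType) (Y : tvsType R) (K : set Y)
    (psi : Y -> R) : set ({scalar Y} * R) :=
  [set p | topological_dual p.1 /\ 0 <= p.2 /\
           forall y, (K `\` [set 0]) y -> 0 < p.1 y - p.2 * psi y].

Definition BP_cone (R : realType) (Y : lmodType R) (psi : Y -> R)
    (f : {scalar Y}) (a : R) : set Y :=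
  [set y | a * psi y <= f y].

Definition BP_cone_gt (R : realType) (Y : lmodType R) (psi : Y -> R)
    (f : {scalar Y}) (a : R) : set Y :=
  [set y | a * psi y < f y].

Definition cor (R : realType) (Y : lmodType R) (M : set Y) : set Y :=
  [set x | M x /\ forall v : Y, exists2 e : R, 0 < e &
           [set x + t *: v | t in `[0, e]] `<=` M].

(* Main.v *)
(* The closures of S_{-K} and S^0_A are disjoint.  If A is closed and convex,
   then cl S^0_A lies in A.  If cl S_{-K} is the slice {y* >= beta} of
   cl B_psi, then y* < beta on B_A, since A meets cl S_{-K} nowhere, and this
   half-space contains 0 and is convex, hence contains S^0_A; each of (i)-(iv)
   makes cl S^0_A stay in it.  As one
   of the closures is compact, 0 is not in the closure of S^0_A - S_{-K}, and
   Hahn-Banach gives a continuous x* with x*(c) + 1 <= x*(d) for c in S_{-K}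
   and d in S^0_A.  With s := inf x*(S^0_A), which is <= 0 because 0 is in
   S^0_A, the level s - 1/2 separates the two sets; it is -alpha.
   Hahn-Banach is obtained by noting that a minimal sublinear map is linear;
   applied to the infimum over t >= 0 and e in E of p (x + t e) - t c, it gives
   the Mazur-Orlicz theorem, which separates E from the unit ball of a gauge
   p. *)
Require Import Defs.
From HB Require Import structures.
From mathcomp Require Import all_boot all_order all_algebra.
From mathcomp Require Import boolp classical_sets functions set_interval.
From mathcomp Require Import reals topology convex normedtype derive.
From mathcomp Require Import interval_inference lra ring.

Set Implicit Arguments.
Unset Strict Implicit.
Unset Printing Implicit Defensive.

Import Order.TTheory GRing.Theory Num.Theory.
Import numFieldNormedType.Exports.

Local Open Scope classical_set_scope.
Local Open Scope ring_scope.

(** * Convex sets and convex hulls *)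

Lemma convex_setP (R : realType) (Y : lmodType R) (A : set Y) :
  convex_set A <->
  forall x y (t : R), A x -> A y -> 0 <= t -> t <= 1 ->
    A (t *: x + (1 - t) *: y).
Proof.
split=> [Aconv x y t Ax Ay t0 t1|Aconv x y l].
  have := Aconv x y (Itv01 t0 t1) (mem_set Ax) (mem_set Ay).
  by move/set_mem.
by rewrite !inE => Ax Ay; exact: Aconv.
Qed.

Lemma convex_hull_convex (R : realType) (Y : lmodType R) (M : set Y) :
  convex_set (convex_hull M).
Proof.
move=> x y l /set_mem xM /set_mem yM; apply: mem_set => C [Cconv MC].
by apply: set_mem; apply: (Cconv); apply: mem_set; [exact: xM|exact: yM].
Qed.

(** * Sublinear maps and the Mazur-Orlicz infimum *)

Section MazurOrlicz.
Context {R : realType} {Y : lmodType R}.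
Implicit Types (p q : Y -> R) (E : set Y) (x y : Y).

(** Homogeneity is an inequality for positive factors, the form that passes directly to infima;
    [sublinearZ] recovers equality. *)
Definition sublinear p : Prop :=
  [/\ forall x y, p (x + y) <= p x + p y,
      forall (r : R) x, 0 < r -> p (r *: x) <= r * p x & p 0 <= 0].

Lemma sublinear_oppr p x : sublinear p -> - p (- x) <= p x.
Proof.
case=> pD _ _; have := pD x (- x); have := pD 0 0.
by rewrite subrr addr0; lra.
Qed.

Lemma sublinearZ p (r : R) x : sublinear p -> 0 <= r -> p (r *: x) = r * p x.
Proof.
move=> [pD pZ p0]; rewrite le_eqVlt => /predU1P[<-|r0].
  have := pD 0 0; rewrite scale0r addr0; lra.
apply/eqP; rewrite eq_le pZ//=.
have ri0 : 0 < r^-1 by rewrite invr_gt0.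
have := pZ _ (r *: x) ri0; rewrite scalerA mulVf ?gt_eqF// scale1r.
by rewrite -ler_pdivlMl.
Qed.

(** For [E] and [c] as assumed below, the infimum of these values is the largest sublinear map below
    [p] that is at most [- c] on [- E]. *)
Definition mo_values p E (c : R) x : set R :=
  [set s | exists t e, [/\ 0 <= t, E e & s = p (x + t *: e) - t * c]].

Definition mo_inf p E c x : R := inf (mo_values p E c x).

Context (p : Y -> R) (E : set Y) (c : R).
Hypothesis psub : sublinear p.
Hypothesis Econv : convex_set E.
Hypothesis En0 : E !=set0.
Hypothesis pE : forall e, E e -> c <= p e.

(** Subadditivity gives [t * c <= p (t *: e) <= p (x + t *: e) + p (- x)]. Without a lower bound
    [inf] would be a default value. *)
Let mo_lb x : lbound (mo_values p E c x) (- p (- x)).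
Proof.
move=> _ [t [e [t0 Ee ->]]]; case: (psub) => pD _ _.
have := pD (x + t *: e) (- x); rewrite addrAC subrr add0r sublinearZ//.
by have := ler_wpM2l t0 (pE Ee); lra.
Qed.

Lemma mo_inf_le x t e : 0 <= t -> E e ->
  mo_inf p E c x <= p (x + t *: e) - t * c.
Proof.
move=> t0 Ee; apply: ge_inf; first by exists (- p (- x)); exact: mo_lb.
by exists t, e.
Qed.

Lemma le_mo_inf x (m : R) :
  (forall t e, 0 <= t -> E e -> m <= p (x + t *: e) - t * c) ->
  m <= mo_inf p E c x.
Proof.
move=> mle; apply: lb_le_inf; last by move=> _ [t [e [t0 Ee ->]]]; exact: mle.
by case: En0 => e Ee; exists (p (x + 0 *: e) - 0 * c), 0, e.
Qed.

Lemma mo_inf_le_self x : mo_inf p E c x <= p x.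
Proof.
by case: En0 => e Ee; have := mo_inf_le x (lexx 0) Ee;
  rewrite scale0r mul0r addr0 subr0.
Qed.

Lemma mo_inf_opp e : E e -> mo_inf p E c (- e) <= - c.
Proof.
move=> Ee; have := mo_inf_le (- e) ler01 Ee; rewrite scale1r addNr mul1r.
by case: psub => _ _; lra.
Qed.

Lemma mo_inf_sublinear : sublinear (mo_inf p E c).
Proof.
case: (psub) => pD pZ p0; split=> [x y|r x r0|].
- rewrite -lerBlDr; apply: le_mo_inf => t e t0 Ee.
  rewrite lerBlDr [leRHS]addrC -lerBlDr; apply: le_mo_inf => s d s0 Ed.
  (* For [t + s = 0] the weights below make no sense, and subadditivity of [p] suffices. *)
  have [ts0|ts0] := eqVneq (t + s) 0.
    have t00 : t = 0 by lra.
    have s00 : s = 0 by lra.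
    rewrite t00 s00 !scale0r !mul0r !addr0 !subr0.
    by have := pD x y; have := mo_inf_le_self (x + y); lra.
  have tsgt0 : 0 < t + s by lra.
  (* By convexity [t *: e + s *: d] is [t + s] times a point of [E]. *)
  have w0 : 0 <= t / (t + s) by rewrite divr_ge0// ltW.
  have w1 : t / (t + s) <= 1 by rewrite ler_pdivrMr//; lra.
  have := mo_inf_le (x + y) (ltW tsgt0)
    ((convex_setP E).1 Econv _ _ _ Ee Ed w0 w1).
  have -> : (t + s) *: (t / (t + s) *: e + (1 - t / (t + s)) *: d)
      = t *: e + s *: d.
    by rewrite scalerDr !scalerA; congr (_ *: _ + _ *: _); field.
  have := pD (x + t *: e) (y + s *: d); rewrite addrACA; lra.
- rewrite -ler_pdivrMl//; apply: le_mo_inf => t e t0 Ee.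
  rewrite ler_pdivrMl//.
  have := mo_inf_le (r *: x) (mulr_ge0 (ltW r0) t0) Ee.
  rewrite -scalerA -scalerDr; have := pZ _ (x + t *: e) r0; lra.
- by have := mo_inf_le_self 0; lra.
Qed.

End MazurOrlicz.

(** * The Hahn-Banach and Mazur-Orlicz theorems *)

Section HahnBanach.
Context {R : realType} {Y : lmodType R}.
Implicit Types (p q : Y -> R).

(** Zorn's lemma for the reversed pointwise order: the pointwise infimum of a chain is again
    sublinear. *)
Lemma exists_minimal_sublinear p : sublinear p ->
  exists q, [/\ sublinear q, forall x, q x <= p x &
    forall r, sublinear r -> (forall x, r x <= q x) -> forall x, q x <= r x].
Proof.
move=> psub; pose T := {q : Y -> R | sublinear q /\ forall x, q x <= p x}.
pose below (s r : T) : bool := `[< forall x, sval r x <= sval s x >].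
pose p' : T := exist _ p (conj psub (fun x => lexx (p x))).
have [| | |q qmin] := @ZL_preorder T p' below.
- by move=> s; apply/asboolP.
- move=> r s t /asboolP rs /asboolP st; apply/asboolP => x.
  exact: le_trans (st x) (rs x).
(* Adjoining [p'] keeps the infimum meaningful for the empty chain. *)
- move=> A Atot; pose A' := [set t | A t \/ t = p'].
  pose V x := [set sval t x | t in A'].
  pose m x := inf (V x).
  have p'le (t : T) : below p' t by apply/asboolP; case: (svalP t).
  have A'tot : total_on A' below.
    by move=> s t [As|->] [At|->]; [exact: Atot|right|left|left].
  have mle t x : A' t -> m x <= sval t x.
    move=> At; apply: ge_inf; last by exists t.
    exists (- p (- x)) => _ [s _ <-]; case: (svalP s) => ssub sp.
    by have := sublinear_oppr x ssub; have := sp (- x); lra.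
  have lem x a : (forall t, A' t -> a <= sval t x) -> a <= m x.
    move=> ale; apply: lb_le_inf; first by exists (p x), p' => //; right.
    by move=> _ [t At <-]; exact: ale.
  have msub : sublinear m.
    split=> [x y|r x r0|].
    + rewrite -lerBlDr; apply: (lem) => t At.
      rewrite lerBlDr [leRHS]addrC -lerBlDr; apply: (lem) => s As.
      rewrite lerBlDr.
      (* The smaller of the two comparable maps lies below both, so its subadditivity suffices. *)
      have [/asboolP st|/asboolP st] := A'tot _ _ At As.
        have [/(_ x y) + _ _] := (svalP s).1.
        by have := mle s (x + y) As; have := st x; lra.
      have [/(_ x y) + _ _] := (svalP t).1.
      by have := mle t (x + y) At; have := st y; lra.
    + rewrite -ler_pdivrMl//; apply: lem => t At; rewrite ler_pdivrMl//.
      apply: le_trans (mle t _ At) _.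
      by case: (svalP t).1 => _ + _; apply.
    + have A'p : A' p' by right.
      by apply: le_trans (mle _ 0 A'p) _; case: (psub).
  have mp x : m x <= p x by apply: (mle p'); right.
  exists (exist _ m (conj msub mp)) => s As; apply/asboolP => x.
  by apply: mle; left.
- exists (sval q); case: (svalP q) => qsub qp; split=> // r rsub rq.
  have rp x : r x <= p x := le_trans (rq x) (qp x).
  have /asboolP : below (exist _ r (conj rsub rp)) q.
    by apply: qmin; apply/asboolP.
  by [].
Qed.

(* A minimal sublinear map [q] equals its own Mazur-Orlicz infimum over {y}
   with constant [q y]; evaluating at [- y] shows that [q] is odd. *)
Lemma hahn_banach p : sublinear p ->
  exists f : {scalar Y}, forall x, f x <= p x.
Proof.
move=> /exists_minimal_sublinear[q [qsub qp qmin]].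
have qN y : q (- y) = - q y.
  have Econv : convex_set [set y].
    apply/convex_setP => _ _ t -> -> _ _ /=.
    by rewrite -scalerDl addrC subrK scale1r.
  have yn0 : [set y] !=set0 by exists y.
  have qy e : [set y] e -> q y <= q e by move=> ->.
  have := qmin _ (mo_inf_sublinear qsub Econv yn0 qy)
    (mo_inf_le_self qsub yn0 qy) (- y).
  have := @mo_inf_opp _ _ _ _ _ qsub qy y erefl.
  have := sublinear_oppr y qsub; lra.
have qD x y : q (x + y) = q x + q y.
  have [qD _ _] := qsub.
  have := qD x y; have := qD (x + y) (- y); rewrite addrK qN; lra.
have qZ (r : R) x : q (r *: x) = r * q x.
  have [r0|r0] := leP 0 r; first exact: sublinearZ.
  rewrite -[r]opprK scaleNr qN sublinearZ ?oppr_ge0 1?ltW//.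
  by rewrite !mulNr.
have qlin : scalar q by move=> a x y; rewrite qD qZ.
pose f : {scalar Y} := HB.pack q (GRing.isLinear.Build R Y R *%R q qlin).
by exists f.
Qed.

(** A linear [f] below the infimum has [f (- e) <= - c], which linearity turns into [c <= f e]. *)
Lemma mazur_orlicz p (E : set Y) (c : R) : sublinear p ->
  convex_set E -> E !=set0 -> (forall e, E e -> c <= p e) ->
  exists f : {scalar Y}, (forall x, f x <= p x) /\ forall e, E e -> c <= f e.
Proof.
move=> psub Econv En0 pE.
have [f fle] := hahn_banach (mo_inf_sublinear psub Econv En0 pE).
exists f; split=> [x|e Ee].
  exact: le_trans (fle x) (mo_inf_le_self psub En0 pE x).
have := le_trans (fle (- e)) (mo_inf_opp psub pE Ee).
by rewrite linearN lerN2.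
Qed.

End HahnBanach.

(** * The Minkowski gauge of a convex absorbing set *)

Section Gauge.
Context {R : realType} {Y : lmodType R}.
Variable U : set Y.
Hypothesis Uconv : convex_set U.
Hypothesis Uabs : forall x, exists2 t : R, 0 < t & U (t^-1 *: x).

Definition gauge (x : Y) : R := inf [set t | 0 < t /\ U (t^-1 *: x)].

Lemma gauge_le x (t : R) : 0 < t -> U (t^-1 *: x) -> gauge x <= t.
Proof.
by move=> t0 Utx; apply: ge_inf; [exists 0 => s [/ltW]|split].
Qed.

Lemma le_gauge x (m : R) :
  (forall t, 0 < t -> U (t^-1 *: x) -> m <= t) -> m <= gauge x.
Proof.
move=> mle; apply: lb_le_inf; last by move=> t [t0 Ut]; exact: mle.
by have [t t0 Ut] := Uabs x; exists t.
Qed.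

Lemma gauge_absorbing0 : U 0.
Proof. by have [t _] := Uabs 0; rewrite scaler0. Qed.

Lemma gauge_le1 x : U x -> gauge x <= 1.
Proof. by move=> Ux; apply: gauge_le => //; rewrite invr1 scale1r. Qed.

(** If [x] were in [t U] with [t < 1], it would be a convex combination of a point of [U] and
    [0]. *)
Lemma gauge_ge1 x : ~ U x -> 1 <= gauge x.
Proof.
move=> NUx; apply: le_gauge => t t0 Ut; rewrite leNgt; apply/negP => t1.
apply: NUx; have := (convex_setP U).1 Uconv _ _ _ Ut gauge_absorbing0
  (ltW t0) (ltW t1).
by rewrite scaler0 addr0 scalerA divff ?gt_eqF// scale1r.
Qed.

Lemma gauge_sublinear : sublinear gauge.
Proof.
split=> [x y|r x r0|].
- rewrite -lerBlDr; apply: le_gauge => s s0 Us.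
  rewrite lerBlDr [leRHS]addrC -lerBlDr; apply: le_gauge => t t0 Ut.
  rewrite lerBlDr; have st0 : 0 < s + t by rewrite addr_gt0.
  rewrite [leRHS]addrC; apply: gauge_le => //; rewrite scalerDr.
  (* [(x + y) / (s + t)] is the convex combination of [x / s] and [y / t] with weight [s / (s + t)]
     on the first. *)
  have w0 : 0 <= s / (s + t) by rewrite divr_ge0// ltW.
  have w1 : s / (s + t) <= 1 by rewrite ler_pdivrMr//; lra.
  have := (convex_setP U).1 Uconv _ _ _ Us Ut w0 w1.
  rewrite !scalerA.
  have -> : s / (s + t) / s = (s + t)^-1 by field; lra.
  by have -> : (1 - s / (s + t)) / t = (s + t)^-1 by field; lra.
- rewrite -ler_pdivrMl//; apply: le_gauge => t t0 Ut.
  rewrite ler_pdivrMl//; apply: gauge_le; first exact: mulr_gt0.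
  by rewrite scalerA invfM mulrAC mulVf ?gt_eqF// mul1r.
- apply/ler_addgt0Pr => e e0; rewrite add0r; apply: gauge_le => //.
  by rewrite scaler0; exact: gauge_absorbing0.
Qed.

End Gauge.

(** * Separation of convex sets by continuous functionals *)

Section Separation.
Context {R : realType} {Y : tvsType R}.
Implicit Types (U E C D : set Y).

(** Scaling is continuous at [(0, x)], so small multiples of [x] lie in [U]. *)
Lemma nbhs0_absorbing U : nbhs 0 U ->
  forall x, exists2 t : R, 0 < t & U (t^-1 *: x).
Proof.
move=> U0 x; have /= := @scale_continuous R Y (0, x) U.
rewrite scale0r => /(_ U0)[[B1 B2]] /= [/nbhs_ballP[e /= e0 eB1] B2x] BU.
exists (e / 2)^-1; first by rewrite invr_gt0 divr_gt0.
apply: (BU ((e / 2)^-1^-1, x)); split=> /=; last exact: nbhs_singleton.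
apply: eB1; rewrite invrK /ball /= sub0r normrN ger0_norm; lra.
Qed.

(** On the symmetric neighbourhood formed by [U] and [- U] one has [|f| <= 1]; scaling it by [e] and
    translating it to [x] gives continuity. *)
Lemma bounded_above_continuous (f : {scalar Y}) U : nbhs 0 U ->
  (forall u, U u -> f u <= 1) -> continuous f.
Proof.
move=> U0 fU x; apply/cvgrPdist_le => e e0.
have V0 : nbhs 0 (U `&` -%R @` U) by apply: filterI => //; exact: nbhs0N.
have := nbhsT x (nbhs0Z (lt0r_neq0 e0) V0).
apply: filterS => _ [_ [v [Uv [w Uw wv]] <-] <-].
rewrite linearD linearZ/= opprD addNKr normrN normrM gtr0_norm//.
rewrite ger_pMr// ler_norml fU// andbT lerNl -linearN -wv opprK.
exact: fU.
Qed.

(** A convex neighbourhood of [0] that misses [E] has a gauge that is at least 1 on [E], so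
    Mazur-Orlicz applies with constant 1. *)
Lemma separation0 E : convex_set E -> E !=set0 -> ~ closure E 0 ->
  exists f : {scalar Y}, continuous f /\ forall e, E e -> 1 <= f e.
Proof.
move=> Econv En0 /existsNP[V /not_implyP[V0 EV]].
have [B Bconv [Bopen /(_ 0 _ V0)[U [BU U0] UV]]] := @locally_convex R Y.
have nU : nbhs 0 U by apply: open_nbhs_nbhs; split=> //; exact: Bopen.
have Uconv : convex_set U by apply: Bconv; rewrite inE.
have Uabs := nbhs0_absorbing nU.
have EU e : E e -> 1 <= gauge U e.
  move=> Ee; apply: gauge_ge1 => // Ue; apply: EV; exists e.
  by split=> //; exact: UV.
have [f [fle fE]] := mazur_orlicz (gauge_sublinear Uconv Uabs) Econv En0 EU.
exists f; split=> //; apply: (bounded_above_continuous nU) => u Uu.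
exact: le_trans (fle u) (gauge_le1 Uu).
Qed.

(** Continuity of addition at [(x, 0)] gives the claim near each [x] in [C]; compactness makes it
    uniform. *)
Lemma compact_closed_gap C D : compact C -> closed D -> C `&` D = set0 ->
  \forall y \near (0 : Y), forall x, C x -> ~ D (x + y).
Proof.
move=> /compact_near_coveringP Ccov Dcl CD.
apply: (Ccov Y (nbhs 0) (fun y x => ~ D (x + y))) => x Cx.
have /= := @add_continuous Y (x, 0) (~` D); rewrite addr0; apply.
apply: open_nbhs_nbhs; split; first exact: closed_openC.
by move=> Dx; have : (C `&` D) x by []; rewrite CD.
Qed.

Lemma convex_diff C D : convex_set C -> convex_set D ->
  convex_set [set d - c | d in D & c in C].
Proof.
move=> /convex_setP Cconv /convex_setP Dconv.
apply/convex_setP => _ _ t [d Dd [c Cc <-]] [d' Dd' [c' Cc' <-]] t0 t1.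
exists (t *: d + (1 - t) *: d'); first exact: Dconv.
exists (t *: c + (1 - t) *: c'); first exact: Cconv.
by rewrite !scalerBr opprD addrACA.
Qed.

Lemma strict_separation C D : convex_set C -> convex_set D ->
  C !=set0 -> D !=set0 -> closure C `&` closure D = set0 ->
  compact (closure C) \/ compact (closure D) ->
  exists f : {scalar Y}, continuous f /\
    forall c d, C c -> D d -> f c + 1 <= f d.
Proof.
move=> Cconv Dconv [c0 Cc0] [d0 Dd0] CD cpt.
have gap : \forall y \near (0 : Y),
    forall c d, closure C c -> closure D d -> d - c <> y.
  case: cpt => cpt.
    have := compact_closed_gap cpt (@closed_closure _ D) CD.
    apply: filterS => y gap c d Cc Dd dcy; apply: (gap c Cc).
    by rewrite -dcy addrC subrK.
  (* With [D] compact the roles are exchanged, and the neighbourhood of [0] is reflected. *)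
  rewrite setIC in CD.
  have := nbhs0N (compact_closed_gap cpt (@closed_closure _ C) CD).
  apply: filterS => _ [y gap <-] c d Cc Dd dcy; apply: (gap d Dd).
  by rewrite -[y]opprK -dcy opprB addrC subrK.
have [|||f [fcont fE]] := @separation0 [set d - c | d in D & c in C].
- exact: convex_diff.
- by exists (d0 - c0), d0 => //; exists c0.
- move=> /(_ _ gap)[_ [[d Dd [c Cc <-]] /(_ c d)]].
  by apply => //; exact: subset_closure.
exists f; split=> // c d Cc Dd.
have : [set d - c | d in D & c in C] (d - c) by exists d => //; exists c.
by move=> /fE; rewrite linearB/=; lra.
Qed.

End Separation.

(** * Seminorms, bases of cones and the interior of Bishop-Phelps cones *)

Lemma seminorm0 (R : realType) (Y : lmodType R) (psi : Y -> R) :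
  seminorm psi -> psi 0 = 0.
Proof. by move=> [_ psiZ]; rewrite -(scale0r 0) psiZ normr0 mul0r. Qed.

Lemma seminormN (R : realType) (Y : lmodType R) (psi : Y -> R) (x : Y) :
  seminorm psi -> psi (- x) = psi x.
Proof.
by move=> [_ psiZ]; rewrite -scaleN1r psiZ normrN normr1 mul1r.
Qed.

Lemma cone_scale (R : realType) (Y : lmodType R) (C : set Y) (r : R) (x : Y) :
  cone C -> 0 <= r -> C x -> C (r *: x).
Proof. by move=> [_ CE] r0 Cx; rewrite CE; exists r => //; exists x. Qed.

Lemma base_normalize (R : realType) (Y : lmodType R) (psi : Y -> R)
    (C : set Y) (x : Y) : seminorm psi -> cone C -> C x -> 0 < psi x ->
  base C psi ((psi x)^-1 *: x).
Proof.
move=> [_ psiZ] Ccone Cx x0; split.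
  by apply: cone_scale => //; rewrite invr_ge0 ltW.
by rewrite psiZ normfV gtr0_norm// mulVf// gt_eqF.
Qed.

Lemma oppset_base (R : realType) (Y : lmodType R) (psi : Y -> R) (C : set Y)
    (x : Y) : seminorm psi -> base C psi x -> base (oppset C) psi (- x).
Proof.
by move=> psis [Cx x1]; split; [exists x|rewrite seminormN].
Qed.

Lemma nontrivial_cone_exists (R : realType) (Y : lmodType R) (C : set Y) :
  cone C -> nontrivial C -> exists x, (C `\` [set 0]) x.
Proof.
move=> [C0 _] [Cneq0 _]; apply: contrapT => NC; apply: Cneq0.
apply/seteqP; split=> [_ ->//|x Cx]; apply: contrapT => x0.
by apply: NC; exists x.
Qed.

(* A boundary point [x] leaves the cone in the direction [v], because
   [psi x <= psi (x + e *: v) + e * psi v]. *)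
Lemma BP_cone_gt_cor (R : realType) (Y : tvsType R) (psi : Y -> R)
    (f : {scalar Y}) (a : R) (v : Y) : seminorm psi -> 0 <= a ->
  f v + a * psi v < 0 -> BP_cone_gt psi f a = cor (BP_cone psi f a).
Proof.
move=> psis a0 fv; have [psiD psiZ] := psis.
apply/seteqP; split=> [x /= fx|x [fx /(_ v)[e e0 xe]]].
  split=> [|w]; first exact: ltW.
  (* [g] is the slack at [x], and moving by [t *: w] costs at most [t * h]; the added 1 keeps the
     divisor positive. *)
  set g := f x - a * psi x; set h := a * psi w - f w.
  have g0 : 0 < g by rewrite subr_gt0.
  have h1 : 0 < `|h| + 1 by rewrite ltr_wpDl.
  exists (g / (`|h| + 1)); first exact: divr_gt0.
  move=> _ [t /= + <-]; rewrite in_itv/= => /andP[t0].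
  rewrite ler_pdivlMr// => tg.
  have := psiD x (t *: w); rewrite psiZ ger0_norm// => /(ler_wpM2l a0).
  rewrite /BP_cone/= linearD linearZ/=.
  have := ler_wpM2l t0 (ler_norm h).
  by rewrite /g /h in tg *; lra.
rewrite /BP_cone_gt/= ltNge; apply/negP => fxle.
have /xe : [set x + t *: v | t in `[0, e]] (x + e *: v).
  by exists e => //=; rewrite in_itv/= lexx ltW.
rewrite /BP_cone/= linearD linearZ/=.
have := psiD (x + e *: v) (- e *: v).
rewrite scaleNr addrK -scaleNr psiZ normrN gtr0_norm// => /(ler_wpM2l a0).
have : e * (f v + a * psi v) < 0 by rewrite pmulr_rlt0.
lra.
Qed.

(** * Half-spaces and closed hulls inside them *)

Section HalfSpaces.
Context {R : realType} {Y : tvsType R}.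
Variable f : {scalar Y}.

Lemma convex_halfspace_lt (b : R) : convex_set [set x | f x < b].
Proof.
apply/convex_setP => x y t /= fx fy t0 t1; rewrite linearD !linearZ/=.
(* Strictness is taken from the [x] term, which vanishes when [t = 0]. *)
have [->|tneq0] := eqVneq t 0; first by rewrite subr0 mul0r mul1r add0r.
have tgt0 : 0 < t by rewrite lt0r tneq0.
have : t * f x < t * b by rewrite ltr_pM2l.
have : (1 - t) * f y <= (1 - t) * b by rewrite ler_wpM2l// ?subr_ge0// ltW.
lra.
Qed.

Lemma convex_halfspace_le (b : R) : convex_set [set x | f x <= b].
Proof.
apply/convex_setP => x y t /= fx fy t0 t1; rewrite linearD !linearZ/=.
have : t * f x <= t * b by rewrite ler_wpM2l.
have : (1 - t) * f y <= (1 - t) * b by rewrite ler_wpM2l// subr_ge0.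
lra.
Qed.

Hypothesis fcont : continuous f.

Lemma closed_halfspace_le (b : R) : closed [set x | f x <= b].
Proof. exact: (closed_comp (fun x _ => @fcont x) (@closed_le R b)). Qed.

(** The maximum of [f] on [X] is below [b], so the hull lies in a closed half-space [f <= c] with
    [c < b], which survives closure. *)
Lemma closure_hull_lt (B X : set Y) (b : R) : 0 < b -> compact X ->
  B `<=` X -> X `<=` [set x | f x < b] ->
  closure (convex_hull ([set 0] `|` B)) `<=` [set x | f x < b].
Proof.
move=> b0 Xcpt BX Xb.
have [c [cb c0 Xc]] : exists c, [/\ c < b, 0 <= c & forall x, X x -> f x <= c].
  have [[x0 Xx0]|X0] := pselect (X !=set0); last first.
    by exists 0; split=> // x Xx; case: X0; exists x.
  have [x /set_mem Xx xmax] := compact_EVT_max (ex_intro _ x0 Xx0) Xcpt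
    (continuous_subspaceT fcont).
  (* The maximum with 0 accounts for the point [0] adjoined to [B]. *)
  exists (Num.max 0 (f x)); split; first by rewrite gt_max b0; exact: Xb.
    by rewrite le_max lexx.
  by move=> y Xy; rewrite le_max xmax ?orbT// inE.
have hullc : convex_hull ([set 0] `|` B) `<=` [set x | f x <= c].
  apply: smallest_sub; first exact: convex_halfspace_le.
  by move=> x [->|/BX/Xc//] /=; rewrite linear0.
move=> x /(closure_subset hullc); rewrite -(closure_id _).1; last first.
  exact: closed_halfspace_le.
by move=> /= /le_lt_trans; apply.
Qed.

End HalfSpaces.

(** * Disjointness of the two closed hulls *)

Section ClosedHulls.
Context {R : realType} {Y : tvsType R}.
Variables (psi : Y -> R) (K A : set Y).
Hypothesis AK : A `&` closure (convex_hull (oppset K)) = [set 0].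
Hypothesis SK0 : ~ closure (base_hull (oppset K) psi) 0.

(** Since the base hull lies in the convex hull of [- K], [AK] forces a common point to be [0],
    which [SK0] excludes. *)
Lemma closure_base_hull_notin x :
  closure (base_hull (oppset K) psi) x -> ~ A x.
Proof.
move=> SKx Ax; suff x0 : x = 0 by apply: SK0; rewrite -x0.
suff : (A `&` closure (convex_hull (oppset K))) x by rewrite AK.
split=> //; apply: (closure_subset _ SKx); apply: sub_smallest2r.
  exact: convex_hull_convex.
by move=> y [].
Qed.

Lemma closure_hulls_disjoint_convex : A 0 -> closed A -> convex_set A ->
  closure (base_hull (oppset K) psi) `&` closure (base_hull0 A psi) = set0.
Proof.
move=> A0 Acl Aconv; rewrite -subset0 => x [/closure_base_hull_notin + SAx].
apply; rewrite [A](closure_id _).1//; apply: closure_subset SAx.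
by apply: smallest_sub => // y [->|[]].
Qed.

Lemma closure_hulls_disjoint_slice (f : {scalar Y}) (b : R) :
  continuous f -> 0 < b ->
  closure (base_hull (oppset K) psi) =
    [set x | closure (unit_ball psi) x /\ b <= f x] ->
  [\/ compact (base A psi), closed (base_hull0 A psi),
      closed A /\ compact (closure (base A psi)) |
      closed A /\ closed (convex_hull (closure (base A psi) `|` [set 0]))] ->
  closure (base_hull (oppset K) psi) `&` closure (base_hull0 A psi) = set0.
Proof.
move=> fcont b0 SKE cases.
suff SAb : closure (base_hull0 A psi) `<=` [set x | f x < b].
  rewrite -subset0 => x [+ /SAb /=]; rewrite SKE => -[_ bx].
  by rewrite ltNge bx.
have Ab x : A x -> closure (unit_ball psi) x -> f x < b.
  move=> Ax xball; rewrite ltNge; apply/negP => bx.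
  by apply: (@closure_base_hull_notin x) => //; rewrite SKE.
have ball1 : base A psi `<=` unit_ball psi.
  by move=> x [_ x1]; rewrite /unit_ball/= x1.
have Bb : base A psi `<=` [set x | f x < b].
  by move=> x Bx; apply: Ab; [case: Bx|exact/subset_closure/ball1].
have clBb : closed A -> closure (base A psi) `<=` [set x | f x < b].
  move=> Acl x clBx; apply: Ab; last exact: closure_subset clBx.
  rewrite [A](closure_id _).1//; apply: closure_subset clBx.
  by move=> y [].
have zb : [set 0] `<=` [set x | f x < b].
  by move=> _ -> /=; rewrite linear0.
case: cases => [Bcpt|SAcl|[Acl clBcpt]|[Acl hullcl]].
- exact: (closure_hull_lt fcont b0 Bcpt).
- rewrite -(closure_id _).1//; apply: smallest_sub.
    exact: convex_halfspace_lt.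
  by rewrite subUset.
- by apply: (closure_hull_lt fcont b0 clBcpt);
    [exact: subset_closure|exact: clBb].
(* The hull of the closed base is itself closed, so it contains the closure of
   [base_hull0 A psi]. *)
- apply: (@subset_trans _ (convex_hull (closure (base A psi) `|` [set 0]))).
    rewrite [X in _ `<=` X](closure_id _).1//.
    apply: closure_subset; apply: sub_smallest2r.
      exact: convex_hull_convex.
    by rewrite setUC; apply: setSU; exact: subset_closure.
  apply: smallest_sub; first exact: convex_halfspace_lt.
  by rewrite subUset; split=> //; exact: clBb.
Qed.

End ClosedHulls.

(** * Choice of the functional and of the level [a] *)

Theorem corollary27 (R : realType) (Y : tvsType R) (psi : Y -> R)
    (K A : set Y)
    (psi_seminorm : seminorm psi)
    (K_cone : cone K) (K_nontrivial : nontrivial K)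
    (A_cone : cone A) (A_nontrivial : nontrivial A)
    (K_base : normlike_base K psi) (A_base : normlike_base A psi)
    (compactness : compact (closure (base_hull (oppset K) psi)) \/
                   compact (closure (base_hull0 A psi)))
    (AK : A `&` closure (convex_hull (oppset K)) = [set 0])
    (SK0 : ~ closure (base_hull (oppset K) psi) 0)
    (ab :
      (closed A /\ convex_set A)
      \/
      ((exists (ys : {scalar Y}) (b : R),
          topological_dual ys /\ 0 < b /\
          closure (base_hull (oppset K) psi) =
            [set x | closure (unit_ball psi) x /\ b <= ys x]) /\
       (compact (base A psi)
        \/ closed (base_hull0 A psi)
        \/ (closed A /\ compact (closure (base A psi)))
        \/ (closed A /\
            closed (convex_hull (closure (base A psi) `|` [set 0])))))) :
  exists (xs : {scalar Y}) (a : R),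
    aug_dual_sharp K psi (xs, a) /\ 0 < a /\
    A `&` oppset (BP_cone psi xs a) = [set 0] /\
    K `\` [set 0] `<=` BP_cone_gt psi xs a /\
    BP_cone_gt psi xs a = cor (BP_cone psi xs a).
Proof.
have [A0 _] := A_cone.
have disj : closure (base_hull (oppset K) psi) `&`
    closure (base_hull0 A psi) = set0.
  case: ab => [[Acl Aconv]|[[ys [b [ysd [b0 SKE]]]] cases]].
    exact: closure_hulls_disjoint_convex.
  apply: (closure_hulls_disjoint_slice AK SK0 ysd b0 SKE).
  case: cases => [?|[?|[?|?]]];
    [exact: Or41|exact: Or42|exact: Or43|exact: Or44].
have [k Kk] := nontrivial_cone_exists K_cone K_nontrivial.
have SK x : (K `\` [set 0]) x ->
    base_hull (oppset K) psi (- ((psi x)^-1 *: x)).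
  move=> Kx; apply: sub_gen_smallest; apply: oppset_base => //.
  by apply: base_normalize => //; [case: Kx|exact: K_base].
have SA0 : base_hull0 A psi 0 by apply: sub_gen_smallest; left.
have [||f [fcont fsep]] := @strict_separation _ _ _ _
  (@convex_hull_convex _ _ _) (@convex_hull_convex _ _ _) _ _ disj compactness.
- by exists (- ((psi k)^-1 *: k)); exact: SK.
- by exists 0.
pose s := inf [set f d | d in base_hull0 A psi].
have sle d : base_hull0 A psi d -> s <= f d.
  move=> SAd; apply: ge_inf; last by exists d.
  (* Any point of the hull for [- K] bounds [f] below on the other hull, so [s] is a true
     infimum. *)
  exists (f (- ((psi k)^-1 *: k)) + 1) => _ [d' SAd' <-].
  by apply: fsep => //; exact: SK.
have les c : base_hull (oppset K) psi c -> f c + 1 <= s.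
  move=> SKc; apply: lb_le_inf; first by exists (f 0), 0.
  by move=> _ [d SAd <-]; exact: fsep.
have s0 : s <= 0 by rewrite -(linear0 f); exact: sle.
pose a := 2^-1 - s.
have a0 : 0 < a by rewrite /a; lra.
have fK x : (K `\` [set 0]) x -> a * psi x < f x.
  move=> Kx; have x0 := K_base _ Kx.
  (* After normalization [f x / psi x >= 1 - s], which exceeds [a] by one half. *)
  have := les _ (SK _ Kx); rewrite linearN linearZ/= => fx.
  by rewrite -ltr_pdivlMr// mulrC /a; lra.
have fA x : (A `\` [set 0]) x -> - (a * psi x) < f x.
  move=> Ax; have x0 := A_base _ Ax.
  have /sle : base_hull0 A psi ((psi x)^-1 *: x).
    by apply: sub_gen_smallest; right; apply: base_normalize => //; case: Ax.
  rewrite linearZ/= => fx.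
  by rewrite -mulNr -ltr_pdivlMr// mulrC /a; lra.
exists f, a; split; [|split=> //; split; [|split=> //]].
- by split=> //=; split=> [|y /fK]; [exact: ltW|rewrite subr_gt0].
- apply/seteqP; split=> [x [Ax [y fy yx]]|_ ->].
    apply: contrapT => x0; have := fA x (conj Ax x0).
    have := fy; rewrite /BP_cone/= -yx linearN (seminormN _ psi_seminorm).
    lra.
  split=> //; exists 0; last exact: oppr0.
  by rewrite /BP_cone/= linear0 (seminorm0 psi_seminorm) mulr0.
(* The direction [- k] leaves the cone because [a * psi k < f k]. *)
- apply: (@BP_cone_gt_cor _ _ _ _ _ (- k)) => //; first exact: ltW.
  by rewrite linearN (seminormN _ psi_seminorm); have := fK _ Kk; lra.
Qed.
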